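(* Consider a nonatomic mixed-autonomy congestion game with cost function drawn from the class $\mathcal{C}_{k,\sigma}$. Let $z^{\mathrm{EQ}}$ be an equilibrium and $z^{\mathrm{OPT}}$ a social optimum for this game. Then $$C(z^{\mathrm{EQ}})\le \frac{k^{\sigma}}{1-\xi(\sigma)}\,C(z^{\mathrm{OPT}}),\qquad \text{where } \xi(\sigma)=\sigma(\sigma+1)^{-\frac{\sigma+1}{\sigma}}.$$
   Context: Game: a directed network with $n$ roads (links) and $m$ origin-destination pairs; the $j$-th pair has demand $\alpha_j\ge 0$ of human-driven flow and $\beta_j\ge 0$ of autonomous flow. Drivers are nonatomic. A routing is a vector $z=(x_1,y_1,\ldots,x_n,y_n)\in\mathbb{R}_{\ge 0}^{2n}$, where $x_i,y_i$ are the human-driven and autonomous flows on road $i$; it is feasible if it routes all demand of both types from origins to destinations, respecting conservation of flow. Both vehicle types on road $i$ experience latency $c_i(x_i,y_i)$. The social cost is $C(z)=\sum_{i=1}^n c_i(x_i,y_i)(x_i+y_i)$. A (Wardrop) equilibrium is a feasible routing in which all users sharing an origin and destination use paths of equal latency and no unused path has smaller latency. A social optimum is a feasible routing minimizing $C$. Cost functions: the latency on road $i$ is $$c_i(x_i,y_i)=t_i\Big(1+\rho_i\Big(\tfrac{x_i+y_i}{m_i(x_i,y_i)}\Big)^{\sigma_i}\Big),\qquad t_i\ge 0,\ \rho_i\ge 0,\ \sigma_i\ge 1,$$ where, with $\alpha(x_i,y_i)=y_i/(x_i+y_i)$ and constants $d_i,h_i,\bar h_i>0$ (road length, nonplatooned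 spacing, platooned spacing; no order between $h_i$ and $\bar h_i$ is assumed), the capacity $m_i$ is given by either capacity model 1, $$m_i(x_i,y_i)=\frac{d_i}{\alpha(x_i,y_i)\bar h_i+(1-\alpha(x_i,y_i))h_i},$$ or capacity model 2, $$m_i(x_i,y_i)=\frac{d_i}{\alpha^2(x_i,y_i)\bar h_i+(1-\alpha^2(x_i,y_i))h_i}.$$ At $x_i=y_i=0$ the quotient $(x_i+y_i)/m_i(x_i,y_i)$ is taken to be $0$. The maximum degree of asymmetry is $k=\max_{i}\max(h_i/\bar h_i,\ \bar h_i/h_i)$ and the maximum polynomial degree is $\sigma=\max_i\sigma_i$ (maxima over all roads). $\mathcal{C}_{k,\sigma}$ is the class of network cost functions whose road latencies are $c_i(x_i,y_i)=t_i\big(1+\rho_i\big(\tfrac{x_i+y_i}{m_i(x_i,y_i)}\big)^{\sigma_i}\big)$ with $t_i\ge 0$, $\rho_i\ge 0$, $\sigma_i\ge 1$ and $m_i$ given by capacity model 1 or capacity model 2, with maximum degree of asymmetry $k$ and maximum polynomial degree $\sigma$. *)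

(* Defs.v *)
From HB Require Import structures.
From mathcomp Require Import all_boot all_order all_algebra.
From mathcomp Require Import all_classical all_reals all_analysis.

Set Implicit Arguments.
Unset Strict Implicit.
Unset Printing Implicit Defensive.

Import Order.TTheory GRing.Theory Num.Theory.
Local Open Scope ring_scope.

Inductive capacity_model := Model1 | Model2.

(* Each road has its own capacity model, so a network may mix the two.        *)
Record road (R : realType) := Road {
  road_t : R;
  road_rho : R;
  road_sigma : R;
  road_d : R;     (* length *)
  road_h : R;     (* nonplatooned spacing *)
  road_hbar : R;  (* platooned spacing *)
  road_model : capacity_model;
  road_t_ge0 : 0 <= road_t;
  road_rho_ge0 : 0 <= road_rho;
  road_sigma_ge1 : 1 <= road_sigma;
  road_d_gt0 : 0 < road_d;
  road_h_gt0 : 0 < road_h;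
  road_hbar_gt0 : 0 < road_hbar
}.

(* In every function of a pair of flows below, x is the human-driven flow and *)
(* y is the autonomous flow.                                                  *)
Definition autonomy (R : realType) (x y : R) : R := y / (x + y).

Definition capacity (R : realType) (r : road R) (x y : R) : R :=
  let a := match road_model r with
           | Model1 => autonomy x y
           | Model2 => autonomy x y ^+ 2
           end in
  road_d r / (a * road_hbar r + (1 - a) * road_h r).

(* On an empty road, (x + y) / capacity r x y is 0 / (d / h) = 0, as division *)
(* by zero yields zero in autonomy.                                           *)
Definition latency (R : realType) (r : road R) (x y : R) : R :=
  road_t r *
    (1 + road_rho r * ((x + y) / capacity r x y) `^ road_sigma r).

Definition asymmetry (R : realType) (r : road R) : R :=
  Num.max (road_h r / road_hbar r) (road_hbar r / road_h r).

(* Every asymmetry and every exponent is at least 1, so the default value 1   *)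
(* of these maxima only matters in a network without roads.                   *)
Definition max_asymmetry (R : realType) (n : nat) (c : 'I_n -> road R) : R :=
  \big[Num.max/1]_(i < n) asymmetry (c i).

Definition max_degree (R : realType) (n : nat) (c : 'I_n -> road R) : R :=
  \big[Num.max/1]_(i < n) road_sigma (c i).

Definition cost_class (R : realType) (n : nat) (k sigma : R)
    (c : 'I_n -> road R) : Prop :=
  max_asymmetry c = k /\ max_degree c = sigma.

(* Roads are named edges: parallel roads and self-loops are allowed.          *)
Record game (R : realType) (n m : nat) := Game {
  vertex : finType;
  src : 'I_n -> vertex;
  dst : 'I_n -> vertex;
  roads : 'I_n -> road R;
  origin : 'I_m -> vertex;
  destination : 'I_m -> vertex;
  human_demand : 'I_m -> R;
  auto_demand : 'I_m -> R;
  human_demand_ge0 : forall j, 0 <= human_demand j;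
  auto_demand_ge0 : forall j, 0 <= auto_demand j
}.

(* z i = (x_i, y_i) *)
Definition routing (R : realType) (n : nat) := 'I_n -> R * R.

Section Game.
Variables (R : realType) (n m : nat) (G : game R n m).

Definition road_latency (z : routing R n) (i : 'I_n) : R :=
  latency (roads G i) (z i).1 (z i).2.

Definition social_cost (z : routing R n) : R :=
  \sum_(i < n) road_latency z i * ((z i).1 + (z i).2).

(* f j i is the flow of the j-th origin-destination pair on road i. Both      *)
(* indicators are 1 when the origin and the destination coincide.             *)
Definition conserves (demand : 'I_m -> R) (f : 'I_m -> 'I_n -> R) : Prop :=
  (forall j i, 0 <= f j i) /\
  (forall j (v : vertex G),
     \sum_(i < n | src G i == v) f j i - \sum_(i < n | dst G i == v) f j i
     = demand j * ((v == origin G j)%:R - (v == destination G j)%:R)).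

Definition feasible (z : routing R n) : Prop :=
  exists X Y : 'I_m -> 'I_n -> R,
    [/\ conserves (human_demand G) X,
        conserves (auto_demand G) Y &
        forall i, z i = (\sum_(j < m) X j i, \sum_(j < m) Y j i)].

Definition social_optimum (z : routing R n) : Prop :=
  feasible z /\ forall z', feasible z' -> social_cost z <= social_cost z'.

Fixpoint is_walk (u v : vertex G) (p : seq 'I_n) : bool :=
  if p is i :: q then (src G i == u) && is_walk (dst G i) v q else u == v.

(* Paths do not repeat vertices. They therefore do not repeat roads, and so   *)
(* bounding their length by the number n of roads loses none of them.         *)
Definition is_path (j : 'I_m) (p : {bseq n of 'I_n}) : bool :=
  is_walk (origin G j) (destination G j) p &&
  uniq (origin G j :: [seq dst G i | i <- p]).

Definition path_latency (z : routing R n) (p : {bseq n of 'I_n}) : R :=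
  \sum_(i <- p) road_latency z i.

Definition path_assignment (demand : 'I_m -> R)
    (f : 'I_m -> {bseq n of 'I_n} -> R) : Prop :=
  (forall j p, 0 <= f j p) /\
  (forall j, \sum_(p | is_path j p) f j p = demand j).

Definition path_load (f : 'I_m -> {bseq n of 'I_n} -> R) (i : 'I_n) : R :=
  \sum_(j < m) \sum_(p | is_path j p && (i \in p)) f j p.

(* A routing records road flows only. It is an equilibrium when some          *)
(* assignment F (human-driven), A (autonomous) of the users to paths induces  *)
(* it and satisfies Wardrop's conditions.                                     *)
Definition equilibrium (z : routing R n) : Prop :=
  feasible z /\
  exists F A : 'I_m -> {bseq n of 'I_n} -> R,
    let used j p := 0 < F j p \/ 0 < A j p in
    [/\ path_assignment (human_demand G) F,
        path_assignment (auto_demand G) A,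
        forall i, z i = (path_load F i, path_load A i),
        forall j p q, is_path j p -> is_path j q -> used j p -> used j q ->
          path_latency z p = path_latency z q &
        forall j p q, is_path j p -> is_path j q -> used j p -> ~ used j q ->
          path_latency z p <= path_latency z q].

End Game.

Definition xi (R : realType) (sigma : R) : R :=
  sigma * (sigma + 1) `^ (- ((sigma + 1) / sigma)).

(* Main.v *)
Require Import Defs.
From HB Require Import structures.
From mathcomp Require Import all_boot all_order all_algebra.
From mathcomp Require Import all_classical all_reals all_analysis.
From mathcomp Require Import ring lra.

(** The bound is a smoothness argument. Write l_i(z) for the latency of road i
and f_i = x_i + y_i for its total flow.

Only total flows enter the equilibrium condition, because both vehicle types
experience the same latency. An equilibrium z therefore satisfies the
variational inequality C(z) <= sum_i l_i(z) f'_i for every feasible z', even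
though these latencies need not come from a potential in (x, y)
([equilibrium_variational]). Its proof
freezes the latencies at z: the equilibrium sends every user along a shortest
path, and by weak duality between shortest paths and flows (vertex potentials,
[flow_cost_ge]) no flow meets the same demand at a smaller cost.

Each term of the right-hand side is then compared with the two social costs:
  l(z) f' <= k^sigma l(z') f' + xi(sigma) l(z) f     ([latency_smooth]).
With p the inverse capacity at z, the congestion (f p)^s f' is first compared
with (f' p)^s f', which is a one-variable inequality in r = f' / f whose
optimal constant is xi: the maximum of r - r^(s+1) ([young_xi],
[monomial_smooth]). Replacing p by the inverse capacity p' at z' then costs a
factor k^s, because both are convex combinations of h / d and hbar / d
([capacity_inv_le]); the same argument serves both capacity models.

Summing over the roads gives C(z) <= k^sigma C(z') + xi(sigma) C(z), and
xi(sigma) < 1 ([xi_lt1]) allows solving for C(z). *)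

Set Implicit Arguments.
Unset Strict Implicit.
Unset Printing Implicit Defensive.

Import Order.TTheory GRing.Theory Num.Theory.
Local Open Scope ring_scope.

(** * The constant xi *)

Lemma xi_ge0 (R : realType) (S : R) : 0 <= S -> 0 <= xi S.
Proof. by move=> S0; rewrite mulr_ge0 ?powR_ge0. Qed.

(** xi S = S / (S + 1) * (S + 1)^(-1/S), a product of a factor below 1 and one
at most 1. *)
Lemma xi_lt1 (R : realType) (S : R) : 0 < S -> xi S < 1.
Proof.
move=> S0; have S1 : S + 1 != 0 by lra.
have -> : 1 = (S + 1) * (S + 1) `^ (- 1) by rewrite powR_inv1 ?divff //; lra.
rewrite /xi; apply: (@le_lt_trans _ _ (S * (S + 1) `^ (- 1))).
  apply: ler_wpM2l; first exact: ltW.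
  apply: ler_powR; first lra.
  rewrite lerN2 mulrDl divff ?gt_eqF // lerDl divr_ge0 //; lra.
by rewrite ltr_pM2r ?powR_gt0; lra.
Qed.

(** Young's inequality for r * (S + 1)^-1 with the conjugate exponents S + 1 and
(S + 1) / S; the second factor is the one for which the leftover constant is
the maximum xi S of r - r^(S+1). *)
Lemma young_xi (R : realType) (S r : R) :
  0 < S -> 0 <= r -> r <= r `^ S * r + xi S.
Proof.
move=> S0 r0.
have S1 : 0 < S + 1 by lra.
have hpq : (S + 1)^-1 + ((S + 1) / S)^-1 = 1 by field; rewrite !gt_eqF.
have hb : 0 <= (S + 1)^-1 by rewrite invr_ge0 ltW.
have := conjugate_powR r0 hb S1 (divr_gt0 S1 S0) hpq.
rewrite -(ler_pM2l S1); congr (_ <= _).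
  by field; rewrite gt_eqF.
have -> : (S + 1)^-1 `^ ((S + 1) / S) = (S + 1) `^ (- ((S + 1) / S)).
  by rewrite -powR_inv1 ?ltW // -powRrM mulN1r.
have -> : r `^ (S + 1) = r `^ S * r.
  by rewrite powRD ?powRr1 //; apply/implyP; rewrite gt_eqF.
by rewrite /xi; field; rewrite !gt_eqF.
Qed.

(** After division by u^(s+1) this is an inequality in r = v / u. For r <= 1
lowering the exponent from S to s does not decrease r^S, so the constant of the
largest exponent serves all roads; for r > 1 the first term alone suffices. *)
Lemma monomial_smooth (R : realType) (s S u v : R) :
  1 <= s -> s <= S -> 0 <= u -> 0 <= v ->
  u `^ s * v <= v `^ s * v + xi S * (u `^ s * u).
Proof.
move=> s1 sS u0 v0.
have X0 : 0 <= xi S by apply: xi_ge0; lra.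
move: u0; rewrite le_eqVlt => /predU1P[<-|u0].
  rewrite powR0 ?gt_eqF ?mul0r ?mulr0 ?addr0 ?mulr_ge0 ?powR_ge0 //; lra.
have [r r0 ->] : exists2 r, 0 <= r & v = r * u.
  by exists (v / u); [rewrite divr_ge0 ?(ltW u0) | rewrite divfK ?gt_eqF].
suff H : r <= r `^ s * r + xi S.
  rewrite (powRM s r0 (ltW u0)).
  have : 0 <= u `^ s * u by rewrite mulr_ge0 ?powR_ge0 ?(ltW u0).
  move=> /ler_wpM2l /(_ _ _ H); apply: etrans.
  by congr (_ <= _); ring.
have [r1|/ltW r1] := leP r 1.
  apply: (le_trans (@young_xi _ S r _ r0)); first lra.
  rewrite lerD2r ler_wpM2r //.
  move: r0; rewrite le_eqVlt => /predU1P[<-|r0].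
    by rewrite !powR0 // gt_eqF //; lra.
  by apply: ger_powR => //; rewrite r0.
rewrite -[leLHS]addr0 lerD // ler_peMl //.
by rewrite -[leLHS](powRr0 r) ler_powR //; lra.
Qed.

(** * Smoothness of the road latencies *)

Lemma convex_ratio_le (R : realType) (A g h a b : R) :
  1 <= A -> 0 < g -> 0 < h -> g <= A * h -> h <= A * g ->
  0 <= a <= 1 -> 0 <= b <= 1 ->
  a * g + (1 - a) * h <= A * (b * g + (1 - b) * h).
Proof.
move=> A1 g0 h0 gh hg /andP[a0 a1] /andP[b0 b1].
have gg : g <= A * g by rewrite ler_peMl // ltW.
have hh : h <= A * h by rewrite ler_peMl // ltW.
have ag : g <= A * (b * g + (1 - b) * h) by nra.
have ah : h <= A * (b * g + (1 - b) * h) by nra.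
nra.
Qed.

Lemma autonomy_bounds (R : realType) (x y : R) :
  0 <= x -> 0 <= y -> 0 <= autonomy x y <= 1.
Proof.
move=> x0 y0; rewrite /autonomy divr_ge0 ?addr_ge0 //=.
have [->|xy] := eqVneq (x + y) 0; first by rewrite invr0 mulr0.
by rewrite ler_pdivrMr ?mul1r ?lerDr // lt0r xy addr_ge0.
Qed.

(** Both capacity models have this form; they differ only in the weight a. This
is the one place where the models are distinguished. *)
Lemma capacity_convex (R : realType) (r : road R) (x y : R) :
  0 <= x -> 0 <= y -> exists2 a, 0 <= a <= 1 &
  (capacity r x y)^-1 = (a * road_hbar r + (1 - a) * road_h r) / road_d r.
Proof.
move=> x0 y0; have a01 := autonomy_bounds x0 y0.
rewrite /capacity; case: (road_model r).
  by exists (autonomy x y); rewrite ?invf_div.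
exists (autonomy x y ^+ 2); rewrite ?invf_div //.
by case/andP: a01 => a0 a1; rewrite exprn_ge0 //= exprn_ile1.
Qed.

Lemma capacity_inv_gt0 (R : realType) (r : road R) (x y : R) :
  0 <= x -> 0 <= y -> 0 < (capacity r x y)^-1.
Proof.
move=> x0 y0; have [a /andP[a0 a1] ->] := capacity_convex r x0 y0.
have g0 := road_hbar_gt0 r; have h0 := road_h_gt0 r.
rewrite divr_gt0 ?road_d_gt0 //.
have [a2|a2] := leP a (1 / 2); nra.
Qed.

Lemma capacity_inv_le (R : realType) (r : road R) (k x y x' y' : R) :
  asymmetry r <= k -> 1 <= k -> 0 <= x -> 0 <= y -> 0 <= x' -> 0 <= y' ->
  (capacity r x y)^-1 <= k * (capacity r x' y')^-1.
Proof.
rewrite /asymmetry ge_max => /andP[k1 k2] k0 x0 y0 x0' y0'.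
have [a a01 ->] := capacity_convex r x0 y0.
have [b b01 ->] := capacity_convex r x0' y0'.
rewrite mulrA ler_wpM2r ?invr_ge0 ?(ltW (road_d_gt0 r)) //.
apply: convex_ratio_le => //; rewrite ?road_h_gt0 ?road_hbar_gt0 //.
  by rewrite -ler_pdivrMr ?road_h_gt0.
by rewrite -ler_pdivrMr ?road_hbar_gt0.
Qed.

Lemma latency_ge0 (R : realType) (r : road R) (x y : R) : 0 <= latency r x y.
Proof.
by rewrite mulr_ge0 ?road_t_ge0 // addr_ge0 // mulr_ge0 ?powR_ge0 ?road_rho_ge0.
Qed.

(** The constant part t of the latency contributes t f', which k^S >= 1 absorbs.
In the congestion part, u = f p and v = f' p in [monomial_smooth] share the
inverse capacity p at (x, y); only afterwards is p replaced by p' in the term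
(f' p)^s, so the factor k^s does not touch the xi term. *)
Lemma latency_smooth (R : realType) (r : road R) (k S x y x' y' : R) :
  asymmetry r <= k -> 1 <= k -> road_sigma r <= S ->
  0 <= x -> 0 <= y -> 0 <= x' -> 0 <= y' ->
  latency r x y * (x' + y') <=
    k `^ S * (latency r x' y' * (x' + y')) + xi S * (latency r x y * (x + y)).
Proof.
move=> rk k1 rS x0 y0 x0' y0'.
have s1 := road_sigma_ge1 r.
have hp := capacity_inv_gt0 r x0 y0.
have hp' := capacity_inv_gt0 r x0' y0'.
have hpp := capacity_inv_le rk k1 x0 y0 x0' y0'.
have f0 : 0 <= x + y by exact: addr_ge0.
have f0' : 0 <= x' + y' by exact: addr_ge0.
rewrite /latency.
move: (road_sigma r) s1 rS => s s1 sS.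
move: (capacity r x y)^-1 (capacity r x' y')^-1 hp hp' hpp => p p' p0 p0' pp.
move: (x + y) (x' + y') f0 f0' => f f' f0 f0'.
have X0 : 0 <= xi S by apply: xi_ge0; lra.
have kS1 : 1 <= k `^ S by rewrite -[leLHS](powRr0 k) ler_powR //; lra.
(* The common factor p of both sides is cancelled. *)
have H1 : (f * p) `^ s * f' <= (f' * p) `^ s * f' + xi S * ((f * p) `^ s * f).
  rewrite -(ler_pM2r p0).
  have := monomial_smooth s1 sS (mulr_ge0 f0 (ltW p0)) (mulr_ge0 f0' (ltW p0)).
  by congr (_ <= _); ring.
have H2 : (f' * p) `^ s <= k `^ S * (f' * p') `^ s.
  apply: (@le_trans _ _ (k `^ s * (f' * p') `^ s)); last first.
    by rewrite ler_wpM2r ?powR_ge0 // ler_powR.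
  rewrite -powRM ?mulr_ge0 ?(ltW p0') //; last lra.
  apply: ge0_ler_powR; rewrite ?nnegrE ?mulr_ge0 ?(ltW p0') ?(ltW p0) //; try lra.
  by rewrite mulrCA ler_wpM2l.
have H3 : (f * p) `^ s * f' <=
    k `^ S * ((f' * p') `^ s * f') + xi S * ((f * p) `^ s * f).
  by apply: (le_trans H1); rewrite lerD2r mulrA ler_wpM2r.
have H4 : f' <= k `^ S * f' + xi S * f.
  by rewrite -[leLHS]addr0; apply: lerD; [rewrite ler_peMl | rewrite mulr_ge0].
set U := _ `^ s in H3 *; set V := _ `^ s in H3 *.
have H5 : road_t r * (f' + road_rho r * (U * f')) <= road_t r *
    (k `^ S * f' + xi S * f + road_rho r *
     (k `^ S * (V * f') + xi S * (U * f))).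
  by rewrite ler_wpM2l ?road_t_ge0 // lerD // ler_wpM2l ?road_rho_ge0.
by move: H5; congr (_ <= _); ring.
Qed.

(** * Paths and potentials *)

Section Network.
Variables (R : realType) (n m : nat) (G : game R n m).

Lemma walk_split (p : seq 'I_n) (u v w : vertex G) :
  is_walk u v p -> w \in u :: [seq dst G i | i <- p] ->
  exists q q', p = q ++ q' /\ is_walk u w q.
Proof.
elim: p u => [|i p IH] u /=.
  by move=> _; rewrite inE => /eqP ->; exists [::], [::]; rewrite /= eqxx.
case/andP=> iu hp; rewrite inE => /predU1P[->|/IH - /(_ hp) [q [q' [-> hq]]]].
  by exists [::], (i :: p); rewrite /= eqxx.
by exists (i :: q), q'; rewrite /= iu.
Qed.

Lemma walk_rcons (p : seq 'I_n) (u : vertex G) (i : 'I_n) :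
  is_walk u (src G i) p -> is_walk u (dst G i) (rcons p i).
Proof.
elim: p u => [|j p IH] u /=; first by move=> /eqP ->; rewrite !eqxx.
by case/andP=> -> /IH.
Qed.

Definition simple_walk (u v : vertex G) (p : seq 'I_n) : bool :=
  is_walk u v p && uniq (u :: [seq dst G i | i <- p]).

Lemma simple_walk_uniq u v p : simple_walk u v p -> uniq p.
Proof. by case/andP=> _ /= /andP[_ /map_uniq]. Qed.

Lemma simple_walk_size u v p : simple_walk u v p -> (size p <= n)%N.
Proof.
by move/simple_walk_uniq/card_uniqP => <-; rewrite -[leqRHS]card_ord max_card.
Qed.

(** If the end of the new road is already on the walk, appending the road would
close a cycle; the initial part of the walk that ends there is no longer, since
the costs are nonnegative. *)
Lemma simple_walk_extend (c : 'I_n -> R) u i p :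
  (forall i, 0 <= c i) -> simple_walk u (src G i) p ->
  exists2 q, simple_walk u (dst G i) q &
    \sum_(e <- q) c e <= \sum_(e <- p) c e + c i.
Proof.
move=> c0 /andP[wp up].
have [ip|ip] := boolP (dst G i \in u :: [seq dst G i | i <- p]).
  have [q [q' [pE wq]]] := walk_split wp ip; exists q.
    by move: up; rewrite /simple_walk wq pE map_cat -cat_cons cat_uniq => /andP[].
  by rewrite pE big_cat /= -addrA lerDl addr_ge0 // sumr_ge0.
exists (rcons p i); last by rewrite -cats1 big_cat big_seq1.
by rewrite /simple_walk walk_rcons // map_rcons -rcons_cons rcons_uniq ip up.
Qed.

(** The distance from u to v along simple walks, cut off at L. The cutoff gives
unreachable vertices a finite potential and preserves [potential_le_edge]; in
[flow_cost_ge] it is a lower bound on the distance to the destination, where it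
loses nothing. *)
Definition potential (c : 'I_n -> R) (L : R) (u v : vertex G) : R :=
  \big[Num.min/L]_(p : {bseq n of 'I_n} | simple_walk u v p) \sum_(e <- p) c e.

Lemma potential_le_edge (c : 'I_n -> R) L u i : (forall i, 0 <= c i) ->
  potential c L u (dst G i) <= potential c L u (src G i) + c i.
Proof.
move=> c0; rewrite -lerBlDr; apply: le_bigmin.
  by rewrite lerBlDr (le_trans (bigmin_le_id _ _ _ _)) // lerDl.
move=> p /(simple_walk_extend c0) [q wq qle]; rewrite lerBlDr.
by apply: (@bigmin_inf _ _ _ _ (Bseq (simple_walk_size wq))).
Qed.

Lemma potential_source (c : 'I_n -> R) L u : potential c L u u <= 0.
Proof.
apply: (@bigmin_inf _ _ _ _ (nil_bseq n _)); last by rewrite big_nil.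
by rewrite /simple_walk /= eqxx.
Qed.

(** Weak duality: c i dominates the potential difference along road i, and by
conservation of flow (summation by parts over the vertices) the potential
differences, weighted by the flow, add up to the demand times the difference
between destination and origin. Cycles in the flow cancel, so that no path
decomposition of f is needed. *)
Lemma flow_cost_ge (c : 'I_n -> R) (demand : 'I_m -> R) f j L :
  (forall i, 0 <= c i) -> 0 <= demand j -> conserves G demand f ->
  (forall p : {bseq n of 'I_n}, is_path G j p -> L <= \sum_(e <- p) c e) ->
  demand j * L <= \sum_(i < n) c i * f j i.
Proof.
move=> c0 d0 [f0 fE] Lp.
set P := potential c L (origin G j).
have PL : L <= P (destination G j) by apply: le_bigmin => // p; apply: Lp.
have P0 : P (origin G j) <= 0 by exact: potential_source.
apply: (@le_trans _ _ (\sum_(i < n) (P (dst G i) - P (src G i)) * f j i)); last first.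
  apply: ler_sum => i _; rewrite ler_wpM2r // lerBlDl.
  exact: potential_le_edge.
(* Group the roads by their start, or by their end. *)
have vertex_sum (g : 'I_n -> vertex G) :
    \sum_(i < n) P (g i) * f j i = \sum_v P v * \sum_(i < n | g i == v) f j i.
  rewrite (partition_big g predT) //=; apply: eq_bigr => v _.
  by rewrite mulr_sumr; apply: eq_bigr => i /eqP ->.
under eq_bigr do rewrite mulrBl.
rewrite sumrB !vertex_sum -sumrB.
have -> : \sum_v (P v * (\sum_(i < n | dst G i == v) f j i) -
    P v * \sum_(i < n | src G i == v) f j i) =
    demand j * (P (destination G j) - P (origin G j)).
  transitivity (\sum_v (demand j * (P v * (v == destination G j)%:R) -
                        demand j * (P v * (v == origin G j)%:R))).
    by apply: eq_bigr => v _; rewrite -mulrBr -opprB fE; ring.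
  have pick_sum w : \sum_v demand j * (P v * (v == w)%:R) = demand j * P w.
    rewrite (bigD1 w) //= eqxx mulr1 big1 ?addr0 // => v /negbTE ->.
    by rewrite !mulr0.
  by rewrite sumrB !pick_sum mulrBr.
by rewrite ler_wpM2l //; lra.
Qed.

Lemma road_latency_ge0 (z : routing R n) i : 0 <= road_latency G z i.
Proof. exact: latency_ge0. Qed.

(** * Equilibria *)

Lemma path_load_cost (c : 'I_n -> R) (f : 'I_m -> {bseq n of 'I_n} -> R) :
  \sum_(i < n) c i * path_load G f i =
  \sum_(j < m) \sum_(p | is_path G j p) f j p * \sum_(e <- p) c e.
Proof.
under eq_bigr do rewrite mulr_sumr.
rewrite exchange_big /=; apply: eq_bigr => j _.
transitivity (\sum_(i < n) \sum_(p | is_path G j p) if i \in p then c i * f j p else 0).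
  by apply: eq_bigr => i _; rewrite mulr_sumr -big_mkcondr.
rewrite exchange_big /=; apply: eq_bigr => p hp.
rewrite -big_mkcond /= mulr_sumr [RHS]big_uniq ?(simple_walk_uniq hp) //=.
by apply: eq_bigr => i _; rewrite mulrC.
Qed.

Lemma conserves_sum_ge0 demand f (i : 'I_n) :
  conserves G demand f -> 0 <= \sum_(j < m) f j i.
Proof. by case=> f0 _; apply: sumr_ge0. Qed.

Lemma feasible_ge0 z : feasible G z -> forall i, 0 <= (z i).1 /\ 0 <= (z i).2.
Proof.
by case=> X [Y [hX hY hz]] i; rewrite hz; split; apply: conserves_sum_ge0; eassumption.
Qed.

(** Wardrop's conditions give each origin-destination pair a common latency L of
its used paths, bounding the latency of all its paths from below. A pair
without used paths gets the level 0: the lower bound holds as latencies are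
nonnegative. *)
Lemma equilibrium_levels z (F A : 'I_m -> {bseq n of 'I_n} -> R) :
  let used j p := 0 < F j p \/ 0 < A j p in
  (forall j p q, is_path G j p -> is_path G j q -> used j p -> used j q ->
    path_latency G z p = path_latency G z q) ->
  (forall j p q, is_path G j p -> is_path G j q -> used j p -> ~ used j q ->
    path_latency G z p <= path_latency G z q) ->
  forall j, exists L,
    (forall p, is_path G j p -> L <= path_latency G z p) /\
    (forall p, is_path G j p -> used j p -> path_latency G z p = L).
Proof.
move=> used hu hn j.
have [[p [hp up]]|nu] := pselect (exists p, is_path G j p /\ used j p).
  exists (path_latency G z p); split=> q hq.
    have [uq|nq] := pselect (used j q); last exact: (hn j p q hp hq up nq).
    by rewrite (hu j p q).
  by move=> uq; apply: (hu j q p).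
exists 0; split=> q hq.
  by apply: sumr_ge0 => i _; exact: road_latency_ge0.
by move=> uq; case: nu; exists q.
Qed.

Lemma level_cost z demand (f : 'I_m -> {bseq n of 'I_n} -> R) (L : 'I_m -> R) :
  path_assignment G demand f ->
  (forall j p, is_path G j p -> 0 < f j p -> path_latency G z p = L j) ->
  \sum_(i < n) road_latency G z i * path_load G f i = \sum_(j < m) demand j * L j.
Proof.
case=> f0 fE hL; rewrite path_load_cost; apply: eq_bigr => j _.
rewrite -fE mulr_suml; apply: eq_bigr => p hp.
move: (f0 j p); rewrite le_eqVlt => /predU1P[<-|fp]; first by rewrite !mul0r.
by rewrite -(hL j p hp fp).
Qed.

Lemma flows_cost_ge (c : 'I_n -> R) demand f (L : 'I_m -> R) :
  (forall i, 0 <= c i) -> (forall j, 0 <= demand j) -> conserves G demand f ->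
  (forall j (p : {bseq n of 'I_n}), is_path G j p -> L j <= \sum_(e <- p) c e) ->
  \sum_(j < m) demand j * L j <= \sum_(i < n) c i * \sum_(j < m) f j i.
Proof.
move=> c0 d0 hf hL; under [leRHS]eq_bigr do rewrite mulr_sumr.
by rewrite exchange_big; apply: ler_sum => j _; apply: flow_cost_ge (hL j).
Qed.

(** Both sides are compared with the sum over the pairs of demand times level,
for each vehicle type separately: the levels are the same for both types, as
they have the same latencies, and an equilibrium attains the sum. *)
Lemma equilibrium_variational (z z' : routing R n) :
  equilibrium G z -> feasible G z' ->
  social_cost G z <= \sum_(i < n) road_latency G z i * ((z' i).1 + (z' i).2).
Proof.
case=> _ [F [A [hF hA hz hu hn]]] [X [Y [hX hY hz']]].
have /choice [L hL] := equilibrium_levels hu hn.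
have c0 := road_latency_ge0 z.
have hLp j (p : {bseq n of 'I_n}) :
  is_path G j p -> L j <= \sum_(e <- p) road_latency G z e by apply: (hL j).1.
rewrite /social_cost.
under eq_bigr do rewrite [in X in _ * X]hz mulrDr.
under [leRHS]eq_bigr do rewrite hz' mulrDr.
rewrite !big_split /= lerD //.
  rewrite (level_cost hF (L := L)) => [|j p hp fp].
    exact: flows_cost_ge (@human_demand_ge0 _ _ _ G) hX hLp.
  by apply: (hL j).2 => //; left.
rewrite (level_cost hA (L := L)) => [|j p hp fp].
  exact: flows_cost_ge (@auto_demand_ge0 _ _ _ G) hY hLp.
by apply: (hL j).2 => //; right.
Qed.

End Network.

Theorem theorem1 (R : realType) (n m : nat) (G : game R n m) (k sigma : R)
    (hG : cost_class k sigma (roads G))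
    (zEQ zOPT : routing R n)
    (hEQ : equilibrium G zEQ) (hOPT : social_optimum G zOPT) :
  social_cost G zEQ <= k `^ sigma / (1 - xi sigma) * social_cost G zOPT.
Proof.
case: hG => hk hs; case: hOPT => fOPT _.
have k1 : 1 <= k by rewrite -hk; apply: bigmax_ge_id.
have s1 : 1 <= sigma by rewrite -hs; apply: bigmax_ge_id.
have xi1 : 0 < 1 - xi sigma by rewrite subr_gt0 xi_lt1 //; lra.
rewrite mulrAC ler_pdivlMr // mulrBr mulr1 lerBlDr.
apply: (le_trans (equilibrium_variational hEQ fOPT)).
rewrite [_ * xi _]mulrC /social_cost !mulr_sumr -big_split /=.
apply: ler_sum => i _.
have [x0 y0] := feasible_ge0 hEQ.1 i.
have [x0' y0'] := feasible_ge0 fOPT i.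
apply: latency_smooth => //; first by rewrite -hk; apply: le_bigmax.
by rewrite -hs; apply: le_bigmax.
Qed.
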